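(* Let $\sigma=\sigma(x)\ge0$ be the damping function and $\sigma_\infty=\max_x\sigma(x)$. Consider, on $[-x_0-\delta,x_0+\delta]\times[-y_0,y_0]$, the perfectly matched layer $$\frac{\partial E_z}{\partial t}=-\frac{\partial H_y}{\partial x}+\frac{\partial H_x}{\partial y}-\sigma E_z,\quad \frac{\partial H_y}{\partial t}=-\frac{\partial E_z}{\partial x}-\sigma H_y,\quad \frac{\partial H_x}{\partial t}=\frac{\partial E_z}{\partial y}+\sigma(H_x-P),\quad \frac{\partial P}{\partial t}=\sigma(H_x-P),$$ subject to the boundary conditions $$\frac{1-R_x}{2}E_z\mp\frac{1+R_x}{2}H_y=0\ \text{ at } x=\pm(x_0+\delta),\qquad \frac{1-R_y}{2}E_z\pm\frac{1+R_y}{2}H_x=0\ \text{ at } y=\pm y_0,$$ with real constants $R_x,R_y$. If $|R_j|<1$ for $j=x,y$, then all solutions satisfy $$\frac{d}{dt}\sqrt{\mathcal{E}^{(2)}(t)}\le\sigma_\infty\sqrt{\mathcal{E}^{(2)}(t)},$$ and if $|R_j|=1$ for $j=x,y$, then all solutions satisfy $$\frac{d}{dt}\sqrt{\mathcal{E}^{(2)}_0(t)}\le\sigma_\infty\sqrt{\mathcal{E}^{(2)}_0(t)},$$ where $\mathcal{E}^{(2)}$ and $\mathcal{E}^{(2)}_0$ are the energies defined in the context.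
   Context: $x_0,y_0,\delta>0$. The damping $\sigma(x)\ge0$ is a real function of $x$ only, vanishing for $|x|\le x_0$. All fields are real-valued functions of $(x,y,t)$, $t\ge0$, assumed sufficiently smooth up to the boundary. $\|\cdot\|$ is the $L^2$ norm on the rectangle, $\Gamma_x=\{x:-x_0-\delta\le x\le x_0+\delta\}$, $\Gamma_y=\{y:-y_0\le y\le y_0\}$, and $\|\cdot\|_{\Gamma_x},\|\cdot\|_{\Gamma_y}$ are the $L^2$ norms on these intervals, applied to traces of $E_z$ on the sides $y=\pm y_0$ and $x=\pm(x_0+\delta)$ respectively. For $R_j\neq-1$ put $\gamma_j=(1-R_j)/(1+R_j)\ge0$, so that the boundary conditions read $\gamma_xE_z\mp H_y=0$ at $x=\pm(x_0+\delta)$ and $\gamma_yE_z\pm H_x=0$ at $y=\pm y_0$; for $R_j=-1$ they read $E_z=0$. The energies are $$\mathcal{E}^{(2)}_0(t)=\|E_z(t)\|^2+\|H_y(t)\|^2+\|H_x(t)\|^2+\|P(t)\|^2,$$ $$\mathcal{E}^{(2)}(t)=\mathcal{E}^{(2)}_0(t)+2\int_0^t\Big(\gamma_x\big(\|E_z(t',x_0+\delta)\|^2_{\Gamma_y}+\|E_z(t',-x_0-\delta)\|^2_{\Gamma_y}\big)+\gamma_y\big(\|E_z(t',y_0)\|^2_{\Gamma_x}+\|E_z(t',-y_0)\|^2_{\Gamma_x}\big)\Big)dt'.$$ An inequality $\frac{d}{dt}\sqrt{\mathcal{E}}\le\sigma_\infty\sqrt{\mathcal{E}}$ is understood as $\frac{d}{dt}\mathcal{E}\le2\sigma_\infty\mathcal{E}$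 (equivalent wherever $\mathcal{E}>0$). *)

(* Defs.v *)
(* Stdlib real numbers with Coquelicot's total derivative and integral. *)
From Stdlib Require Import Reals.
From Coquelicot Require Import Coquelicot.
Open Scope R_scope.

(* A field is a function of (x, y, t).  The space-time domain is
   [-a, a] x [-b, b] x [0, +oo); in the theorem a = x0 + delta and b = y0.
   Values outside this domain never matter. *)
Definition field := R -> R -> R -> R.

Definition closed_domain (a b : R) (p : R * R * R) : Prop :=
  let '(x, y, t) := p in - a <= x <= a /\ - b <= y <= b /\ 0 <= t.

Definition open_domain (a b x y t : R) : Prop :=
  - a < x < a /\ - b < y < b /\ 0 < t.

Definition uncurry3 (u : field) (p : R * R * R) : R :=
  let '(x, y, t) := p in u x y t.

(* Class C^1 up to the boundary: u is jointly continuous on the closed domain,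
   and its first partial derivatives exist in the interior and extend
   continuously to the closed domain. *)
Definition C1_up_to_boundary (a b : R) (u : field) : Prop :=
  continuous_on (closed_domain a b) (uncurry3 u) /\
  exists ux uy ut : field,
    continuous_on (closed_domain a b) (uncurry3 ux) /\
    continuous_on (closed_domain a b) (uncurry3 uy) /\
    continuous_on (closed_domain a b) (uncurry3 ut) /\
    forall x y t : R, open_domain a b x y t ->
      is_derive (fun x' => u x' y t) x (ux x y t) /\
      is_derive (fun y' => u x y' t) y (uy x y t) /\
      is_derive (fun t' => u x y t') t (ut x y t).

Definition d_x (u : field) (x y t : R) : R := Derive (fun x' => u x' y t) x.
Definition d_y (u : field) (x y t : R) : R := Derive (fun y' => u x y' t) y.
Definition d_t (u : field) (x y t : R) : R := Derive (fun t' => u x y t') t.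

Definition is_max_on (D : R -> Prop) (f : R -> R) (m : R) : Prop :=
  (exists x : R, D x /\ f x = m) /\ (forall x : R, D x -> f x <= m).

Definition PML_system (a b : R) (sigma : R -> R) (Ez Hy Hx P : field) : Prop :=
  forall x y t : R, open_domain a b x y t ->
    d_t Ez x y t = - d_x Hy x y t + d_y Hx x y t - sigma x * Ez x y t /\
    d_t Hy x y t = - d_x Ez x y t - sigma x * Hy x y t /\
    d_t Hx x y t = d_y Ez x y t + sigma x * (Hx x y t - P x y t) /\
    d_t P x y t = sigma x * (Hx x y t - P x y t).

Definition boundary_x (a b Rx : R) (Ez Hy : field) : Prop :=
  forall y t : R, - b <= y <= b -> 0 <= t ->
    (1 - Rx) / 2 * Ez a y t - (1 + Rx) / 2 * Hy a y t = 0 /\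
    (1 - Rx) / 2 * Ez (- a) y t + (1 + Rx) / 2 * Hy (- a) y t = 0.

Definition boundary_y (a b Ry : R) (Ez Hx : field) : Prop :=
  forall x t : R, - a <= x <= a -> 0 <= t ->
    (1 - Ry) / 2 * Ez x b t + (1 + Ry) / 2 * Hx x b t = 0 /\
    (1 - Ry) / 2 * Ez x (- b) t - (1 + Ry) / 2 * Hx x (- b) t = 0.

(* L^2 norms on [-c, c] and on [-a, a] x [-b, b], as (iterated) Riemann
   integrals; they are only applied to functions continuous on these sets. *)
Definition L2norm1 (c : R) (f : R -> R) : R :=
  sqrt (RInt (fun s => (f s) ^ 2) (- c) c).

Definition L2norm2 (a b : R) (f : R -> R -> R) : R :=
  sqrt (RInt (fun x => RInt (fun y => (f x y) ^ 2) (- b) b) (- a) a).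

Definition gamma (r : R) : R := (1 - r) / (1 + r).

Definition energy0 (a b : R) (Ez Hy Hx P : field) (t : R) : R :=
  (L2norm2 a b (fun x y => Ez x y t)) ^ 2 +
  (L2norm2 a b (fun x y => Hy x y t)) ^ 2 +
  (L2norm2 a b (fun x y => Hx x y t)) ^ 2 +
  (L2norm2 a b (fun x y => P x y t)) ^ 2.

Definition energy (a b Rx Ry : R) (Ez Hy Hx P : field) (t : R) : R :=
  energy0 a b Ez Hy Hx P t +
  2 * RInt (fun t' =>
        gamma Rx * ((L2norm1 b (fun y => Ez a y t')) ^ 2 +
                    (L2norm1 b (fun y => Ez (- a) y t')) ^ 2) +
        gamma Ry * ((L2norm1 a (fun x => Ez x b t')) ^ 2 +
                    (L2norm1 a (fun x => Ez x (- b) t')) ^ 2)) 0 t.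

(* Coquelicot's is_derive with the neighbourhoods of t restricted to
   [0, +oo): the usual derivative for t > 0, the right derivative at t = 0. *)
Definition is_derive_nonneg (E : R -> R) (t l : R) : Prop :=
  filterdiff E (within (fun s => 0 <= s) (locally t)) (fun h : R => scal h l).

(* d/dt sqrt E <= s * sqrt E for all t >= 0, in the form
   dE/dt <= 2 s E, which also makes sense where E vanishes. *)
Definition sqrt_growth_le (s : R) (E : R -> R) : Prop :=
  forall t : R, 0 <= t ->
    exists dE : R, is_derive_nonneg E t dE /\ dE <= 2 * s * E t.

(* Main.v *)
Require Import Defs.
From Stdlib Require Import Reals Lra Classical ClassicalEpsilon.
From Coquelicot Require Import Coquelicot.
Open Scope R_scope.

(** The energy estimate for the damped Maxwell system rests on one pointwise
    inequality.  Write q for the energy density Ez^2 + Hy^2 + Hx^2 + P^2.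
    Multiplying the equations by 2 Ez, 2 Hy, 2 Hx, 2 P and adding gives
      d_t q = - 2 d_x (Ez Hy) + 2 d_y (Ez Hx)
              + 2 sigma (- Ez^2 - Hy^2 + Hx^2 - P^2),
    because the cross terms sigma Hx P cancel; and the last term is at most
    2 sigma_inf q ([pml_pointwise]).  Integrating over the rectangle turns the
    divergence into a boundary flux.  For |R_j| < 1 the boundary conditions
    identify twice this flux with the integrand of the time integral that the
    full energy adds to energy0, so the two cancel in the derivative of the full
    energy ([boundary_flux_absorbing]); for |R_j| = 1 the product Ez Hy or
    Ez Hx vanishes on each side, and so does the flux
    ([boundary_flux_reflecting]).

    The analytic work is to justify this when derivatives are only known in the
    open domain and extend continuously to its closure.  Each field and each
    extended derivative is replaced by its composition with the nearest-point
    retraction onto the closed domain, which is continuous on the whole space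
    ([C1_extension]).  The fundamental theorem of calculus along one variable
    holds for interior values of the other two, and passes to boundary values
    because both sides are continuous in these parameters ([ftc_adherent]).
    The energy is then never differentiated under the integral sign: exchanging
    integrals ([RInt_swap]) writes it as
      energy0 t = energy0 0 + int_0^t (integral of d_t q)
    with a continuous integrand ([area_growth]), so that its derivative, one-sided
    at t = 0, is immediate ([sqrt_growth_le_primitive]).  The damping sigma may be
    very irregular, and it is never integrated: it only enters the pointwise
    inequality, whose two outer sides are continuous. *)

(** * Continuity of combined fields *)

Lemma continuous_Rplus {U : UniformSpace} (f g : U -> R) (p : U) :
  continuous f p -> continuous g p -> continuous (fun q => f q + g q) p.
Proof. exact (@continuous_plus U R_AbsRing R_NormedModule f g p). Qed.

Lemma continuous_Rmult {U : UniformSpace} (f g : U -> R) (p : U) :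
  continuous f p -> continuous g p -> continuous (fun q => f q * g q) p.
Proof. exact (@continuous_mult U R_AbsRing f g p). Qed.

Lemma continuous_Ropp {U : UniformSpace} (f : U -> R) (p : U) :
  continuous f p -> continuous (fun q => - f q) p.
Proof. exact (@continuous_opp U R_AbsRing R_NormedModule f p). Qed.

Lemma continuous_Rminus {U : UniformSpace} (f g : U -> R) (p : U) :
  continuous f p -> continuous g p -> continuous (fun q => f q - g q) p.
Proof. exact (@continuous_minus U R_AbsRing R_NormedModule f g p). Qed.

(** Joint continuity of a curried function whose first argument, a parameter,
    ranges over any uniform space.  It is asked for everywhere, so that all
    integrands below are integrable on every interval. *)
Definition continuous2 {U : UniformSpace} (g : U -> R -> R) : Prop :=
  forall z : U * R, continuous (fun z => g (fst z) (snd z)) z.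

Definition continuous3 (u : field) : Prop :=
  forall p : R * R * R,
    continuous (fun p => u (fst (fst p)) (snd (fst p)) (snd p)) p.

Lemma continuous2_comp {U V : UniformSpace} (g : U -> R -> R)
    (f : V -> U) (h : V -> R) (p : V) :
  continuous2 g -> continuous f p -> continuous h p ->
  continuous (fun q => g (f q) (h q)) p.
Proof.
  intros Hg Hf Hh. apply (continuous_comp_2 f h g p Hf Hh). apply Hg.
Qed.

Lemma continuous3_comp {V : UniformSpace} (u : field) (f g h : V -> R) (p : V) :
  continuous3 u -> continuous f p -> continuous g p -> continuous h p ->
  continuous (fun q => u (f q) (g q) (h q)) p.
Proof.
  intros Hu Hf Hg Hh.
  apply (continuous_comp_2 (fun q => (f q, g q)) h
           (fun z t => u (fst z) (snd z) t) p).
  - apply (continuous_comp_2 f g (fun x y => (x, y)) p Hf Hg).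
    apply continuous_ext with (f := fun z : R * R => z).
    + intros [x y]; reflexivity.
    + apply continuous_id.
  - exact Hh.
  - apply Hu.
Qed.

(** The cases match the shape of the goal syntactically: applying these lemmas by
    higher-order unification loops. *)
Ltac cont :=
  repeat match goal with
    | H : ?G |- ?G => exact H
    | |- continuous (fun z => z) _ => apply continuous_id
    | |- continuous (fun z => ?c) _ => apply continuous_const
    | |- continuous (fun z => @?f z + @?g z) _ => apply (continuous_Rplus f g)
    | |- continuous (fun z => @?f z - @?g z) _ => apply (continuous_Rminus f g)
    | |- continuous (fun z => - @?f z) _ => apply (continuous_Ropp f)
    | |- continuous (fun z => @?f z * @?g z) _ => apply (continuous_Rmult f g)
    | H : continuous3 ?u
      |- continuous (fun z => ?u (@?f z) (@?g z) (@?h z)) _ =>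
        apply (continuous3_comp u f g h _ H)
    | H : continuous2 ?g |- continuous (fun z => ?g (@?f z) (@?h z)) _ =>
        apply (continuous2_comp g f h _ H)
    | H : forall p, continuous ?f p |- continuous ?f _ => apply H
    | H : forall p, continuous ?f p |- continuous (fun z => ?f z) _ => apply H
    | |- continuous fst _ => apply continuous_fst
    | |- continuous snd _ => apply continuous_snd
    | |- continuous (fun z => fst (@?f z)) _ => apply (continuous_comp f fst)
    | |- continuous (fun z => snd (@?f z)) _ => apply (continuous_comp f snd)
    end.

(** * Integrals depending on a parameter *)

(** Compactness of [c, d] makes continuity in the parameter uniform in the
    integration variable: each y has its own radius of continuity at (p, y), and
    a Lebesgue number for these radii serves all y at once. *)
Lemma tube_estimate {U : UniformSpace} (g : U -> R -> R) (c d : R) (p : U)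
    (eps : posreal) :
  continuous2 g ->
  locally p (fun q => forall y, c <= y <= d -> Rabs (g q y - g p y) <= eps).
Proof.
  intros Hg.
  assert (Hloc : forall y, exists r : posreal, forall q z,
             ball p r q -> Rabs (z - y) < r ->
             Rabs (g q z - g p y) < eps / 2).
  { intros y.
    assert (He : 0 < eps / 2) by (destruct eps; simpl; lra).
    destruct (proj1 (filterlim_locally _ _) (Hg (p, y)) (mkposreal _ He))
      as [r Hr].
    exists r. intros q z Hq Hz. apply (Hr (q, z)). split; assumption. }
  set (delta := fun y => proj1_sig (constructive_indefinite_description _ (Hloc y))).
  assert (Hdelta : forall y q z,
             ball p (delta y) q -> Rabs (z - y) < delta y ->
             Rabs (g q z - g p y) < eps / 2).
  { intros y. exact (proj2_sig (constructive_indefinite_description _ (Hloc y))). }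
  destruct (compactness_value_1d c d delta) as [r Hr].
  exists r. intros q Hq y Hy.
  apply Rnot_lt_le. intros Hlt.
  apply (Hr y Hy). intros (s & Hs & Hys & Hrs).
  assert (H1 := Hdelta s q y (ball_le _ _ _ Hrs _ Hq) Hys).
  assert (H2 := Hdelta s p y (ball_center _ _) Hys).
  apply Rabs_def2 in H1. apply Rabs_def2 in H2.
  assert (Rabs (g q y - g p y) < eps) by (apply Rabs_def1; lra).
  lra.
Qed.

Lemma ex_RInt_continuous_everywhere (f : R -> R) (a b : R) :
  (forall x, continuous f x) -> ex_RInt f a b.
Proof.
  intros Hf. apply (ex_RInt_continuous (V := R_CompleteNormedModule)).
  intros x _. apply Hf.
Qed.

Lemma RInt_Rplus (f g : R -> R) (a b : R) :
  (forall x, continuous f x) -> (forall x, continuous g x) ->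
  RInt (fun x => f x + g x) a b = RInt f a b + RInt g a b.
Proof.
  intros Hf Hg.
  apply (RInt_plus (V := R_CompleteNormedModule) f g);
    apply ex_RInt_continuous_everywhere; assumption.
Qed.

Lemma RInt_Rminus (f g : R -> R) (a b : R) :
  (forall x, continuous f x) -> (forall x, continuous g x) ->
  RInt (fun x => f x - g x) a b = RInt f a b - RInt g a b.
Proof.
  intros Hf Hg.
  apply (RInt_minus (V := R_CompleteNormedModule) f g);
    apply ex_RInt_continuous_everywhere; assumption.
Qed.

Lemma RInt_Rmult_l (k : R) (f : R -> R) (a b : R) :
  (forall x, continuous f x) ->
  RInt (fun x => k * f x) a b = k * RInt f a b.
Proof.
  intros Hf. apply (RInt_scal (V := R_CompleteNormedModule) f).
  apply ex_RInt_continuous_everywhere; assumption.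
Qed.

Lemma continuous_RInt_param {U : UniformSpace} (g : U -> R -> R) (c d : R) :
  continuous2 g ->
  forall p : U, continuous (fun q => RInt (g q) c d) p.
Proof.
  intros Hg.
  assert (Hgq : forall q y, continuous (g q) y).
  { intros q y. apply (continuous2_comp g (fun _ => q) (fun y => y)); cont. }
  assert (Hexq : forall q c d, ex_RInt (g q) c d).
  { intros. apply ex_RInt_continuous_everywhere. apply Hgq. }
  assert (Hle : forall c d, c <= d ->
             forall p : U, continuous (fun q => RInt (g q) c d) p).
  { clear c d. intros c d Hcd p. apply filterlim_locally. intros eps.
    (* The extra 1 keeps the denominator positive when c = d. *)
    assert (He : 0 < eps / (d - c + 1)).
    { apply Rdiv_lt_0_compat; [apply cond_pos | lra]. }
    refine (filter_imp _ _ _ (tube_estimate g c d p (mkposreal _ He) Hg)).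
    simpl. intros q Hq.
    change (Rabs (RInt (g q) c d - RInt (g p) c d) < eps).
    rewrite <- RInt_Rminus by apply Hgq.
    apply Rle_lt_trans with ((d - c) * (eps / (d - c + 1))).
    - apply abs_RInt_le_const; [exact Hcd | | exact Hq].
      apply ex_RInt_continuous_everywhere. intros x.
      apply continuous_Rminus; apply Hgq.
    - assert (Heq : (d - c + 1) * (eps / (d - c + 1)) = eps) by (field; lra).
      lra. }
  intros p. destruct (Rle_or_lt c d) as [Hcd | Hdc].
  - apply Hle, Hcd.
  - apply continuous_ext with (f := fun q => - RInt (g q) d c).
    + intros q. apply (opp_RInt_swap (V := R_CompleteNormedModule)), Hexq.
    + apply continuous_Ropp, Hle, Rlt_le, Hdc.
Qed.

Lemma is_derive_primitive (f : R -> R) (a x : R) :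
  (forall s, continuous f s) -> is_derive (fun s => RInt f a s) x (f x).
Proof.
  intros Hf. apply (is_derive_RInt f (fun s => RInt f a s) a x).
  - apply filter_forall. intros s. apply (RInt_correct f).
    apply ex_RInt_continuous_everywhere, Hf.
  - apply Hf.
Qed.

Lemma continuous_primitive (f : R -> R) (a x : R) :
  (forall s, continuous f s) -> continuous (fun s => RInt f a s) x.
Proof.
  intros Hf.
  apply (ex_derive_continuous (V := R_NormedModule) (fun s => RInt f a s)).
  exists (f x).
  apply is_derive_primitive, Hf.
Qed.

(** By the mean value theorem f minus the primitive of df is constant: this only
    uses the derivative inside the interval and continuity at the ends. *)
Lemma ftc_closed (f df : R -> R) (c d : R) :
  c <= d -> (forall x, continuous f x) -> (forall x, continuous df x) ->
  (forall x, c < x < d -> is_derive f x (df x)) ->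
  RInt df c d = f d - f c.
Proof.
  intros Hcd Hf Hdf Hder.
  destruct (MVT_gen (fun x => f x - RInt df c x) c d (fun _ => 0))
    as (z & _ & Hz).
  - rewrite Rmin_left, Rmax_right by exact Hcd. intros x Hx.
    replace 0 with (minus (df x) (df x)) by exact (Rminus_diag_eq _ _ eq_refl).
    apply (is_derive_minus f (fun s => RInt df c s)).
    + apply Hder, Hx.
    + apply is_derive_primitive, Hdf.
  - intros x _. apply continuity_pt_filterlim.
    apply (continuous_Rminus f (fun s => RInt df c s)).
    + apply Hf.
    + apply continuous_primitive, Hdf.
  - rewrite RInt_point in Hz.
    change (@zero _) with 0 in Hz. lra.
Qed.

(** As functions of the upper limit b, both sides vanish at b = a and have
    derivative [fun x => RInt (g x) c d]. *)
Lemma RInt_swap (g : R -> R -> R) (a b c d : R) :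
  continuous2 g ->
  RInt (fun x => RInt (fun y => g x y) c d) a b =
  RInt (fun y => RInt (fun x => g x y) a b) c d.
Proof.
  intros Hg.
  set (inner := fun x => RInt (fun y => g x y) c d).
  assert (Hinner : forall x, continuous inner x).
  { intros x. apply (continuous_RInt_param g c d Hg). }
  assert (Hcol : forall y x, continuous (fun x => g x y) x).
  { intros y x. apply (continuous2_comp g (fun x => x) (fun _ => y)); cont. }
  set (swapped := fun s => RInt (fun y => RInt (fun x => g x y) a s) c d).
  assert (Hpart : forall y s,
             is_derive (fun s => RInt (fun x => g x y) a s) s (g s y)).
  { intros y s. apply (is_derive_primitive (fun x => g x y)), Hcol. }
  assert (Hswapped : forall s, is_derive swapped s (inner s)).
  { intros s.
    replace (inner s)
      with (RInt (fun y => Derive (fun s => RInt (fun x => g x y) a s) s) c d).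
    2:{ apply RInt_ext. intros y _. apply is_derive_unique, Hpart. }
    apply (is_derive_RInt_param (fun s y => RInt (fun x => g x y) a s)).
    - apply filter_forall. intros z y _. exists (g z y). apply Hpart.
    - intros y _. apply continuity_2d_pt_ext with (f := g).
      + intros u v. symmetry. apply is_derive_unique, Hpart.
      + apply continuity_2d_pt_filterlim. apply (Hg (s, y)).
    - apply filter_forall. intros z. apply ex_RInt_continuous_everywhere.
      intros y. apply (continuous_RInt_param (fun y x => g x y)).
      intros w. apply (continuous2_comp g snd fst); cont. }
  change (RInt inner a b = swapped b).
  rewrite (is_RInt_unique inner a b (minus (swapped b) (swapped a))).
  - assert (Hzero : swapped a = 0).
    { unfold swapped. rewrite (RInt_ext _ (fun _ => 0)).
      - rewrite RInt_const. apply Rmult_0_r.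
      - intros y _. apply (RInt_point (V := R_CompleteNormedModule)). }
    rewrite Hzero. apply Rminus_0_r.
  - apply (is_RInt_derive swapped inner).
    + intros x _. apply Hswapped.
    + intros x _. apply Hinner.
Qed.

(** * Passing to the boundary by density *)

Definition adherent {U : UniformSpace} (S : U -> Prop) (p : U) : Prop :=
  forall Q : U -> Prop, locally p Q -> exists q, Q q /\ S q.

Lemma adherent_prod {U V : UniformSpace} (S : U -> Prop) (T : V -> Prop)
    (p : U) (q : V) :
  adherent S p -> adherent T q ->
  adherent (fun z : U * V => S (fst z) /\ T (snd z)) (p, q).
Proof.
  intros HS HT Q [r Hr].
  destruct (HS (ball p r)) as (p' & Hp' & Sp'); [now exists r |].
  destruct (HT (ball q r)) as (q' & Hq' & Tq'); [now exists r |].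
  exists (p', q'). split; [apply Hr; now split | now split].
Qed.

Lemma adherent_segment (c d x : R) :
  c < d -> c <= x <= d -> adherent (fun z => c < z < d) x.
Proof.
  intros Hcd Hx Q [r Hr].
  (* Move x towards the midpoint by a fraction k, small enough to stay within
     distance r. *)
  set (k := Rmin (1 / 2) (r / (2 * (d - c)))).
  assert (Hk : 0 < k <= 1 / 2).
  { split; [| apply Rmin_l]. apply Rmin_glb_lt; [lra |].
    apply Rdiv_lt_0_compat; [apply cond_pos | lra]. }
  assert (Hkr : k * (d - c) < r).
  { apply Rle_lt_trans with (r / (2 * (d - c)) * (d - c)).
    - apply Rmult_le_compat_r; [lra | apply Rmin_r].
    - replace (r / (2 * (d - c)) * (d - c)) with (r / 2) by (field; lra).
      destruct r; simpl; lra. }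
  exists (x + k * ((c + d) / 2 - x)). split; [| nra].
  apply Hr. change (Rabs (x + k * ((c + d) / 2 - x) - x) < r).
  apply Rabs_def1; nra.
Qed.

Lemma adherent_positive (t : R) : 0 <= t -> adherent (fun s => 0 < s) t.
Proof.
  intros Ht Q HQ.
  destruct (adherent_segment t (t + 1) t ltac:(lra) ltac:(lra) Q HQ)
    as (s & HQs & Hs).
  exists s. split; [exact HQs | lra].
Qed.

Lemma le_adherent {U : UniformSpace} (S : U -> Prop) (f g : U -> R) (p : U) :
  adherent S p -> continuous f p -> continuous g p ->
  (forall q, S q -> f q <= g q) -> f p <= g p.
Proof.
  intros Hp Hf Hg Hle. apply Rnot_lt_le. intros Hlt.
  assert (Hgap : 0 < f p - g p) by lra.
  destruct (Hp _ (proj1 (filterlim_locally _ _) (continuous_Rminus f g p Hf Hg)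
                    (mkposreal _ Hgap))) as (q & Hq & Sq).
  change (Rabs (f q - g q - (f p - g p)) < f p - g p) in Hq.
  apply Rabs_def2 in Hq. specialize (Hle q Sq). lra.
Qed.

Lemma eq_adherent {U : UniformSpace} (S : U -> Prop) (f g : U -> R) (p : U) :
  adherent S p -> continuous f p -> continuous g p ->
  (forall q, S q -> f q = g q) -> f p = g p.
Proof.
  intros Hp Hf Hg Heq. apply Rle_antisym.
  - apply (le_adherent S f g p); auto. intros q Sq. rewrite Heq; auto; lra.
  - apply (le_adherent S g f p); auto. intros q Sq. rewrite Heq; auto; lra.
Qed.

(** The derivative is only available for parameters in S.  Both sides of the
    identity are continuous in the parameter, so it persists on the closure of S;
    this reaches the sides of the rectangle and the initial time, where no
    derivative is assumed to exist. *)
Lemma ftc_adherent {U : UniformSpace} (S : U -> Prop) (g dg : U -> R -> R)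
    (c d : R) (p : U) :
  c <= d -> continuous2 g -> continuous2 dg ->
  (forall q x, S q -> c < x < d -> is_derive (g q) x (dg q x)) ->
  adherent S p ->
  RInt (dg p) c d = g p d - g p c.
Proof.
  intros Hcd Hg Hdg Hder Hp.
  apply (eq_adherent S (fun q => RInt (dg q) c d) (fun q => g q d - g q c) p Hp).
  - apply continuous_RInt_param, Hdg.
  - cont.
  - intros q Sq. apply ftc_closed; [exact Hcd | | | intros x; now apply Hder].
    + intros x. apply (continuous2_comp g (fun _ => q) (fun x => x)); cont.
    + intros x. apply (continuous2_comp dg (fun _ => q) (fun x => x)); cont.
Qed.

(** * Extension of the fields to the whole space *)

Definition clamp (lo hi x : R) : R := Rmax lo (Rmin hi x).

Lemma clamp_bounds (lo hi x : R) : lo <= hi -> lo <= clamp lo hi x <= hi.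
Proof.
  intros H. unfold clamp. split; [apply Rmax_l |].
  apply Rmax_lub; [exact H | apply Rmin_l].
Qed.

Lemma clamp_id (lo hi x : R) : lo <= x <= hi -> clamp lo hi x = x.
Proof.
  intros H. unfold clamp. rewrite Rmin_right, Rmax_right; tauto.
Qed.

Lemma Rmax_lipschitz (c x z : R) : Rabs (Rmax c z - Rmax c x) <= Rabs (z - x).
Proof.
  unfold Rmax, Rabs.
  destruct (Rle_dec c x), (Rle_dec c z);
    repeat destruct Rcase_abs; lra.
Qed.

Lemma Rmin_lipschitz (c x z : R) : Rabs (Rmin c z - Rmin c x) <= Rabs (z - x).
Proof.
  unfold Rmin, Rabs.
  destruct (Rle_dec c x), (Rle_dec c z);
    repeat destruct Rcase_abs; lra.
Qed.

(** Composition with the nearest-point retraction onto the closed domain. *)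
Definition clamped (a b : R) (u : field) : field := fun x y t =>
  u (clamp (- a) a x) (clamp (- b) b y) (Rmax 0 t).

Lemma clamped_eq (a b : R) (u : field) (x y t : R) :
  closed_domain a b (x, y, t) -> clamped a b u x y t = u x y t.
Proof.
  intros (Hx & Hy & Ht). unfold clamped.
  now rewrite (clamp_id _ _ x), (clamp_id _ _ y), Rmax_right.
Qed.

Lemma continuous3_clamped (a b : R) (u : field) :
  0 <= a -> 0 <= b -> continuous_on (closed_domain a b) (uncurry3 u) ->
  continuous3 (clamped a b u).
Proof.
  intros Ha Hb Hu [[x y] t]. simpl.
  set (retract := fun p : R * R * R =>
         (clamp (- a) a (fst (fst p)), clamp (- b) b (snd (fst p)),
          Rmax 0 (snd p))).
  assert (Hin : forall p, closed_domain a b (retract p)).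
  { intros p. repeat split; try apply clamp_bounds; try lra. apply Rmax_l. }
  apply (filterlim_comp _ _ _ retract (uncurry3 u) _
           (within (closed_domain a b) (locally (retract (x, y, t))))).
  - intros Q [r Hr]. exists r. intros [[x' y'] t'] [[Bx By] Bt].
    apply Hr; [| apply Hin].
    assert (Hclamp : forall lo hi z z', ball z r z' ->
              ball (clamp lo hi z) r (clamp lo hi z')).
    { intros lo hi z z' Hz. refine (Rle_lt_trans _ _ _ _ Hz).
      eapply Rle_trans; [apply Rmax_lipschitz | apply Rmin_lipschitz]. }
    split; [split; apply Hclamp; assumption |].
    refine (Rle_lt_trans _ _ _ _ Bt). apply Rmax_lipschitz.
  - apply Hu, Hin.
Qed.

(** The functions ux, uy, ut are continuous everywhere, but they are the partial
    derivatives of u in the open domain only: a field extended by a retraction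
    need not be differentiable across the boundary. *)
Definition C1_on_box (a b : R) (u ux uy ut : field) : Prop :=
  (continuous3 u /\ continuous3 ux /\ continuous3 uy /\ continuous3 ut) /\
  forall x y t, open_domain a b x y t ->
    is_derive (fun x' => u x' y t) x (ux x y t) /\
    is_derive (fun y' => u x y' t) y (uy x y t) /\
    is_derive (fun t' => u x y t') t (ut x y t).

Lemma locally_between (lo hi x : R) :
  lo < x < hi -> locally x (fun z => lo < z < hi).
Proof.
  intros Hx. apply filter_and.
  - apply (open_gt lo x), Hx.
  - apply (open_lt hi x), Hx.
Qed.

(** The extension agrees with u near each point of the open domain, so it has the
    same derivatives there. *)
Lemma C1_extension (a b : R) (u : field) :
  0 < a -> 0 < b -> C1_up_to_boundary a b u ->
  exists v vx vy vt : field,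
    C1_on_box a b v vx vy vt /\
    (forall x y t, closed_domain a b (x, y, t) -> v x y t = u x y t) /\
    (forall x y t, open_domain a b x y t ->
       d_x u x y t = vx x y t /\ d_y u x y t = vy x y t /\
       d_t u x y t = vt x y t).
Proof.
  intros Ha Hb (Hu & ux & uy & ut & Hux & Huy & Hut & Hder).
  assert (Hcont : forall w, continuous_on (closed_domain a b) (uncurry3 w) ->
            continuous3 (clamped a b w)).
  { intros w. apply continuous3_clamped; lra. }
  assert (Heq : forall w x y t, open_domain a b x y t ->
            clamped a b w x y t = w x y t).
  { intros w x y t (Hx & Hy & Ht). apply clamped_eq. repeat split; lra. }
  exists (clamped a b u), (clamped a b ux), (clamped a b uy), (clamped a b ut).
  split; [split; [auto |] | split; [intros; now apply clamped_eq |]].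
  - intros x y t Hop. rewrite !Heq by exact Hop.
    destruct (Hder x y t Hop) as (Dx & Dy & Dt).
    destruct Hop as (Hx & Hy & Ht).
    split; [| split].
    + apply (is_derive_ext_loc (fun x' => u x' y t)); [| exact Dx].
      generalize (locally_between _ _ _ Hx). apply filter_imp.
      intros z Hz. symmetry. apply Heq. repeat split; lra.
    + apply (is_derive_ext_loc (fun y' => u x y' t)); [| exact Dy].
      generalize (locally_between _ _ _ Hy). apply filter_imp.
      intros z Hz. symmetry. apply Heq. repeat split; lra.
    + apply (is_derive_ext_loc (fun t' => u x y t')); [| exact Dt].
      generalize (open_gt 0 t Ht). apply filter_imp.
      intros z Hz. symmetry. apply Heq. repeat split; lra.
  - intros x y t Hop. rewrite !Heq by exact Hop.
    destruct (Hder x y t Hop) as (Dx & Dy & Dt).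
    repeat split; now apply is_derive_unique.
Qed.

Lemma C1_mult (a b : R) (u ux uy ut v vx vy vt : field) :
  C1_on_box a b u ux uy ut -> C1_on_box a b v vx vy vt ->
  C1_on_box a b (fun x y t => u x y t * v x y t)
    (fun x y t => ux x y t * v x y t + u x y t * vx x y t)
    (fun x y t => uy x y t * v x y t + u x y t * vy x y t)
    (fun x y t => ut x y t * v x y t + u x y t * vt x y t).
Proof.
  intros ((Cu & Cux & Cuy & Cut) & Du) ((Cv & Cvx & Cvy & Cvt) & Dv).
  split.
  - repeat split; intros p; cont.
  - intros x y t Hop.
    destruct (Du x y t Hop) as (Dux & Duy & Dut).
    destruct (Dv x y t Hop) as (Dvx & Dvy & Dvt).
    split; [| split].
    + apply (is_derive_mult _ _ _ _ _ Dux Dvx). apply Rmult_comm.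
    + apply (is_derive_mult _ _ _ _ _ Duy Dvy). apply Rmult_comm.
    + apply (is_derive_mult _ _ _ _ _ Dut Dvt). apply Rmult_comm.
Qed.

Lemma C1_plus (a b : R) (u ux uy ut v vx vy vt : field) :
  C1_on_box a b u ux uy ut -> C1_on_box a b v vx vy vt ->
  C1_on_box a b (fun x y t => u x y t + v x y t)
    (fun x y t => ux x y t + vx x y t) (fun x y t => uy x y t + vy x y t)
    (fun x y t => ut x y t + vt x y t).
Proof.
  intros ((Cu & Cux & Cuy & Cut) & Du) ((Cv & Cvx & Cvy & Cvt) & Dv).
  split.
  - repeat split; intros p; cont.
  - intros x y t Hop.
    destruct (Du x y t Hop) as (Dux & Duy & Dut).
    destruct (Dv x y t Hop) as (Dvx & Dvy & Dvt).
    split; [| split].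
    + exact (is_derive_plus _ _ _ _ _ Dux Dvx).
    + exact (is_derive_plus _ _ _ _ _ Duy Dvy).
    + exact (is_derive_plus _ _ _ _ _ Dut Dvt).
Qed.

(** * The fundamental theorem of calculus along each variable *)

Lemma C1_ftc_x (a b : R) (u ux uy ut : field) (y t : R) :
  0 < a -> 0 < b -> C1_on_box a b u ux uy ut -> - b <= y <= b -> 0 <= t ->
  RInt (fun x => ux x y t) (- a) a = u a y t - u (- a) y t.
Proof.
  intros Ha Hb ((Cu & Cux & _) & Du) Hy Ht.
  apply (ftc_adherent (fun q : R * R => (- b < fst q < b) /\ 0 < snd q)
           (fun q x => u x (fst q) (snd q)) (fun q x => ux x (fst q) (snd q))
           (- a) a (y, t)).
  - lra.
  - intros p; cont.
  - intros p; cont.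
  - intros [y' t'] x [Hy' Ht'] Hx. now apply Du.
  - apply (adherent_prod (fun z => - b < z < b) (fun s => 0 < s)).
    + apply adherent_segment; lra.
    + now apply adherent_positive.
Qed.

Lemma C1_ftc_y (a b : R) (u ux uy ut : field) (x t : R) :
  0 < a -> 0 < b -> C1_on_box a b u ux uy ut -> - a <= x <= a -> 0 <= t ->
  RInt (fun y => uy x y t) (- b) b = u x b t - u x (- b) t.
Proof.
  intros Ha Hb ((Cu & _ & Cuy & _) & Du) Hx Ht.
  apply (ftc_adherent (fun q : R * R => (- a < fst q < a) /\ 0 < snd q)
           (fun q y => u (fst q) y (snd q)) (fun q y => uy (fst q) y (snd q))
           (- b) b (x, t)).
  - lra.
  - intros p; cont.
  - intros p; cont.
  - intros [x' t'] y [Hx' Ht'] Hy. now apply Du.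
  - apply (adherent_prod (fun z => - a < z < a) (fun s => 0 < s)).
    + apply adherent_segment; lra.
    + now apply adherent_positive.
Qed.

Lemma C1_ftc_t (a b : R) (u ux uy ut : field) (x y t : R) :
  0 < a -> 0 < b -> C1_on_box a b u ux uy ut ->
  - a <= x <= a -> - b <= y <= b -> 0 <= t ->
  RInt (fun s => ut x y s) 0 t = u x y t - u x y 0.
Proof.
  intros Ha Hb ((Cu & _ & _ & Cut) & Du) Hx Hy Ht.
  apply (ftc_adherent
           (fun q : R * R => (- a < fst q < a) /\ (- b < snd q < b))
           (fun q s => u (fst q) (snd q) s) (fun q s => ut (fst q) (snd q) s)
           0 t (x, y)).
  - lra.
  - intros p; cont.
  - intros p; cont.
  - intros [x' y'] s [Hx' Hy'] Hs. now apply Du.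
  - apply (adherent_prod (fun z => - a < z < a) (fun z => - b < z < b));
      apply adherent_segment; lra.
Qed.

Lemma le_on_closed_domain (a b : R) (f g : field) (x y t : R) :
  0 < a -> 0 < b -> continuous3 f -> continuous3 g ->
  (forall x y t, open_domain a b x y t -> f x y t <= g x y t) ->
  closed_domain a b (x, y, t) -> f x y t <= g x y t.
Proof.
  intros Ha Hb Hf Hg Hle (Hx & Hy & Ht).
  apply (le_adherent
           (fun p : R * R * R =>
              (- a < fst (fst p) < a /\ - b < snd (fst p) < b) /\ 0 < snd p)
           (fun p => f (fst (fst p)) (snd (fst p)) (snd p))
           (fun p => g (fst (fst p)) (snd (fst p)) (snd p)) (x, y, t)).
  - apply (adherent_prod
             (fun q : R * R => - a < fst q < a /\ - b < snd q < b)
             (fun s => 0 < s)).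
    + apply (adherent_prod (fun z => - a < z < a) (fun z => - b < z < b));
        apply adherent_segment; lra.
    + now apply adherent_positive.
  - apply Hf.
  - apply Hg.
  - intros [[x' y'] t'] [[Hx' Hy'] Ht']. apply Hle. now repeat split.
Qed.

(** * Integration over the rectangle *)

Definition area (a b : R) (u : field) (t : R) : R :=
  RInt (fun x => RInt (fun y => u x y t) (- b) b) (- a) a.

Lemma continuous2_inner (b : R) (u : field) :
  continuous3 u -> continuous2 (fun t x => RInt (fun y => u x y t) (- b) b).
Proof.
  intros Hu p.
  apply (continuous_RInt_param
           (fun (p : R * R) y => u (snd p) y (fst p)) (- b) b).
  intros q; cont.
Qed.

Lemma continuous_inner (b : R) (u : field) (t x : R) :
  continuous3 u -> continuous (fun x => RInt (fun y => u x y t) (- b) b) x.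
Proof.
  intros Hu.
  apply (continuous2_comp (fun t x => RInt (fun y => u x y t) (- b) b)
           (fun _ => t) (fun x => x)); cont.
  now apply continuous2_inner.
Qed.

Lemma continuous_area (a b : R) (u : field) (t : R) :
  continuous3 u -> continuous (area a b u) t.
Proof.
  intros Hu. apply (continuous_RInt_param _ (- a) a (continuous2_inner b u Hu)).
Qed.

Lemma area_plus (a b : R) (u v : field) (t : R) :
  continuous3 u -> continuous3 v ->
  area a b (fun x y t => u x y t + v x y t) t = area a b u t + area a b v t.
Proof.
  intros Hu Hv. unfold area.
  rewrite <- RInt_Rplus by (intros; now apply continuous_inner).
  apply RInt_ext. intros x _. apply RInt_Rplus; intros y; cont.
Qed.

Lemma area_scal (a b k : R) (u : field) (t : R) :
  continuous3 u ->
  area a b (fun x y t => k * u x y t) t = k * area a b u t.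
Proof.
  intros Hu. unfold area.
  rewrite <- RInt_Rmult_l by (intros; now apply continuous_inner).
  apply RInt_ext. intros x _. apply RInt_Rmult_l; intros y; cont.
Qed.

Lemma area_le (a b : R) (u v : field) (t : R) :
  0 <= a -> 0 <= b -> continuous3 u -> continuous3 v ->
  (forall x y, - a <= x <= a -> - b <= y <= b -> u x y t <= v x y t) ->
  area a b u t <= area a b v t.
Proof.
  intros Ha Hb Hu Hv Hle. apply RInt_le; [lra | | |].
  - apply ex_RInt_continuous_everywhere. intros; now apply continuous_inner.
  - apply ex_RInt_continuous_everywhere. intros; now apply continuous_inner.
  - intros x Hx. apply RInt_le; [lra | | |].
    + apply ex_RInt_continuous_everywhere. intros; cont.
    + apply ex_RInt_continuous_everywhere. intros; cont.
    + intros y Hy. apply Hle; lra.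
Qed.

(** Exchanging the time integral with both space integrals reduces this to the
    fundamental theorem of calculus in t at each point of the rectangle. *)
Lemma area_growth (a b : R) (u ux uy ut : field) (t : R) :
  0 < a -> 0 < b -> C1_on_box a b u ux uy ut -> 0 <= t ->
  area a b u t = area a b u 0 + RInt (area a b ut) 0 t.
Proof.
  intros Ha Hb Hu Ht. pose proof Hu as ((Cu & _ & _ & Cut) & _).
  assert (Hswap : RInt (area a b ut) 0 t =
                  RInt (fun x => RInt (fun y => u x y t - u x y 0) (- b) b)
                    (- a) a).
  { unfold area. rewrite RInt_swap by (now apply continuous2_inner).
    apply RInt_ext. rewrite Rmin_left, Rmax_right by lra. intros x Hx.
    rewrite (RInt_swap (fun s y => ut x y s)) by (intros p; cont).
    apply RInt_ext. rewrite Rmin_left, Rmax_right by lra. intros y Hy.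
    apply (C1_ftc_t a b u ux uy ut); auto; lra. }
  rewrite Hswap.
  rewrite (RInt_ext _ (fun x => RInt (fun y => u x y t) (- b) b -
                                RInt (fun y => u x y 0) (- b) b)).
  - rewrite RInt_Rminus by (intros; now apply continuous_inner).
    unfold area. lra.
  - intros x _. apply RInt_Rminus; intros y; cont.
Qed.

Lemma area_d_x (a b : R) (u ux uy ut : field) (t : R) :
  0 < a -> 0 < b -> C1_on_box a b u ux uy ut -> 0 <= t ->
  area a b ux t = RInt (fun y => u a y t - u (- a) y t) (- b) b.
Proof.
  intros Ha Hb Hu Ht. pose proof Hu as ((_ & Cux & _) & _). unfold area.
  rewrite (RInt_swap (fun x y => ux x y t)) by (intros p; cont).
  apply RInt_ext. rewrite Rmin_left, Rmax_right by lra. intros y Hy.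
  apply (C1_ftc_x a b u ux uy ut); auto; lra.
Qed.

Lemma area_d_y (a b : R) (u ux uy ut : field) (t : R) :
  0 < a -> 0 < b -> C1_on_box a b u ux uy ut -> 0 <= t ->
  area a b uy t = RInt (fun x => u x b t - u x (- b) t) (- a) a.
Proof.
  intros Ha Hb Hu Ht. unfold area.
  apply RInt_ext. rewrite Rmin_left, Rmax_right by lra. intros x Hx.
  apply (C1_ftc_y a b u ux uy ut); auto; lra.
Qed.

(** * The energies *)

Lemma L2norm1_sq (c : R) (f : R -> R) :
  0 <= c -> (forall x, continuous f x) ->
  L2norm1 c f ^ 2 = RInt (fun s => f s ^ 2) (- c) c.
Proof.
  intros Hc Hf. apply pow2_sqrt. apply RInt_ge_0; [lra | |].
  - apply ex_RInt_continuous_everywhere. intros x. simpl. cont.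
  - intros x _. apply pow2_ge_0.
Qed.

Lemma L2norm2_sq (a b : R) (u : field) (t : R) :
  0 <= a -> 0 <= b -> continuous3 u ->
  L2norm2 a b (fun x y => u x y t) ^ 2 =
  area a b (fun x y t => u x y t * u x y t) t.
Proof.
  intros Ha Hb Hu.
  assert (Hsq : RInt (fun x => RInt (fun y => u x y t ^ 2) (- b) b) (- a) a =
                area a b (fun x y t => u x y t * u x y t) t).
  { apply RInt_ext. intros x _. apply RInt_ext. intros y _. simpl. ring. }
  unfold L2norm2. rewrite Hsq. apply pow2_sqrt.
  rewrite <- (Rmult_0_l (area a b u t)), <- area_scal by exact Hu.
  apply area_le; try assumption.
  - intros p; cont.
  - intros p; cont.
  - intros x y _ _. rewrite Rmult_0_l. apply Rle_0_sqr.
Qed.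

Definition energy_density (Ez Hy Hx P : field) : field := fun x y t =>
  Ez x y t * Ez x y t + Hy x y t * Hy x y t +
  Hx x y t * Hx x y t + P x y t * P x y t.

Lemma energy0_area (a b : R) (Ez Hy Hx P : field) (t : R) :
  0 <= a -> 0 <= b ->
  continuous3 Ez -> continuous3 Hy -> continuous3 Hx -> continuous3 P ->
  energy0 a b Ez Hy Hx P t = area a b (energy_density Ez Hy Hx P) t.
Proof.
  intros Ha Hb CE CHy CHx CP. unfold energy0.
  rewrite !L2norm2_sq by assumption.
  rewrite <- !area_plus by (intros p; cont). reflexivity.
Qed.

Lemma within_nonneg_lim (t x : R) :
  0 <= t -> is_filter_lim (within (fun r => 0 <= r) (locally t)) x -> x = t.
Proof.
  intros Ht Hx. apply NNPP. intros Hneq.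
  exact (locally_singleton t _ (Hx _ (open_neq t x Hneq)) Ht eq_refl).
Qed.

Lemma sqrt_growth_le_ext (s : R) (E F : R -> R) :
  (forall t, 0 <= t -> E t = F t) -> sqrt_growth_le s E -> sqrt_growth_le s F.
Proof.
  intros HEF HE t Ht. destruct (HE t Ht) as (dE & Hder & Hle).
  exists dE. split; [| now rewrite <- HEF].
  refine (filterdiff_ext_loc E F _ _ _ Hder).
  - apply (filter_forall (F := locally t)). exact HEF.
  - intros x Hx. rewrite (within_nonneg_lim t x Ht Hx). now apply HEF.
Qed.

(** On the half line E coincides with a primitive of e, which is differentiable
    on the whole line; the derivative of E relative to the half line follows by
    restriction, also at t = 0. *)
Lemma sqrt_growth_le_primitive (s C : R) (E e : R -> R) :
  (forall t, continuous e t) ->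
  (forall t, 0 <= t -> E t = C + RInt e 0 t) ->
  (forall t, 0 <= t -> e t <= 2 * s * E t) ->
  sqrt_growth_le s E.
Proof.
  intros He HE Hle.
  apply sqrt_growth_le_ext with (E := fun r => C + RInt e 0 r).
  { intros t Ht. symmetry. now apply HE. }
  intros t Ht. exists (e t). split; [| rewrite <- HE; auto].
  assert (Hd : is_derive (fun r => C + RInt e 0 r) t (e t)).
  { replace (e t) with (plus zero (e t)) by apply plus_zero_l.
    apply (is_derive_plus (fun _ => C) (fun r => RInt e 0 r)).
    - apply @is_derive_const.
    - now apply is_derive_primitive. }
  destruct Hd as [Hlin Hdom]. split; [exact Hlin |].
  intros x Hx. rewrite (within_nonneg_lim t x Ht Hx).
  apply is_domin_le with (1 := Hdom t (fun Q HQ => HQ)).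
  intros Q HQ. now apply filter_le_within.
Qed.

Lemma L2norm1_ext (c : R) (f g : R -> R) :
  0 <= c -> (forall x, - c <= x <= c -> f x = g x) ->
  L2norm1 c f = L2norm1 c g.
Proof.
  intros Hc H. unfold L2norm1. f_equal. apply RInt_ext.
  rewrite Rmin_left, Rmax_right by lra. intros x Hx. rewrite H by lra.
  reflexivity.
Qed.

Lemma L2norm2_ext (a b : R) (f g : R -> R -> R) :
  0 <= a -> 0 <= b ->
  (forall x y, - a <= x <= a -> - b <= y <= b -> f x y = g x y) ->
  L2norm2 a b f = L2norm2 a b g.
Proof.
  intros Ha Hb H. unfold L2norm2. f_equal.
  apply RInt_ext. rewrite Rmin_left, Rmax_right by lra. intros x Hx.
  apply RInt_ext. rewrite Rmin_left, Rmax_right by lra. intros y Hy.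
  rewrite H by lra. reflexivity.
Qed.

Lemma energy0_ext (a b : R) (Ez Hy Hx P Ez' Hy' Hx' P' : field) (t : R) :
  0 <= a -> 0 <= b -> 0 <= t ->
  (forall x y t, closed_domain a b (x, y, t) -> Ez x y t = Ez' x y t) ->
  (forall x y t, closed_domain a b (x, y, t) -> Hy x y t = Hy' x y t) ->
  (forall x y t, closed_domain a b (x, y, t) -> Hx x y t = Hx' x y t) ->
  (forall x y t, closed_domain a b (x, y, t) -> P x y t = P' x y t) ->
  energy0 a b Ez Hy Hx P t = energy0 a b Ez' Hy' Hx' P' t.
Proof.
  intros Ha Hb Ht EE EHy EHx EP. unfold energy0.
  rewrite (L2norm2_ext a b (fun x y => Ez x y t) (fun x y => Ez' x y t)),
    (L2norm2_ext a b (fun x y => Hy x y t) (fun x y => Hy' x y t)),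
    (L2norm2_ext a b (fun x y => Hx x y t) (fun x y => Hx' x y t)),
    (L2norm2_ext a b (fun x y => P x y t) (fun x y => P' x y t));
    auto; intros x y Hxab Hyab;
    first [apply EE | apply EHy | apply EHx | apply EP]; now repeat split.
Qed.

(** Half the rate at which the time integral in [energy] grows. *)
Definition boundary_loss (a b Rx Ry : R) (Ez : field) (t : R) : R :=
  gamma Rx * (L2norm1 b (fun y => Ez a y t) ^ 2 +
              L2norm1 b (fun y => Ez (- a) y t) ^ 2) +
  gamma Ry * (L2norm1 a (fun x => Ez x b t) ^ 2 +
              L2norm1 a (fun x => Ez x (- b) t) ^ 2).

Lemma boundary_loss_ext (a b Rx Ry : R) (Ez Ez' : field) (t : R) :
  0 <= a -> 0 <= b -> 0 <= t ->
  (forall x y t, closed_domain a b (x, y, t) -> Ez x y t = Ez' x y t) ->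
  boundary_loss a b Rx Ry Ez t = boundary_loss a b Rx Ry Ez' t.
Proof.
  intros Ha Hb Ht HE. unfold boundary_loss.
  rewrite (L2norm1_ext b (fun y => Ez a y t) (fun y => Ez' a y t)),
    (L2norm1_ext b (fun y => Ez (- a) y t) (fun y => Ez' (- a) y t)),
    (L2norm1_ext a (fun x => Ez x b t) (fun x => Ez' x b t)),
    (L2norm1_ext a (fun x => Ez x (- b) t) (fun x => Ez' x (- b) t));
    auto; intros z Hz; apply HE; repeat split; lra.
Qed.

Lemma energy_ext (a b Rx Ry : R) (Ez Hy Hx P Ez' Hy' Hx' P' : field) (t : R) :
  0 <= a -> 0 <= b -> 0 <= t ->
  (forall x y t, closed_domain a b (x, y, t) -> Ez x y t = Ez' x y t) ->
  (forall x y t, closed_domain a b (x, y, t) -> Hy x y t = Hy' x y t) ->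
  (forall x y t, closed_domain a b (x, y, t) -> Hx x y t = Hx' x y t) ->
  (forall x y t, closed_domain a b (x, y, t) -> P x y t = P' x y t) ->
  energy a b Rx Ry Ez Hy Hx P t = energy a b Rx Ry Ez' Hy' Hx' P' t.
Proof.
  intros Ha Hb Ht EE EHy EHx EP. unfold energy.
  rewrite (energy0_ext a b Ez Hy Hx P Ez' Hy' Hx' P') by assumption.
  do 2 f_equal. apply RInt_ext. rewrite Rmin_left, Rmax_right by lra.
  intros s Hs. apply (boundary_loss_ext a b Rx Ry Ez Ez'); auto; lra.
Qed.

Lemma continuous_boundary_loss (a b Rx Ry : R) (Ez : field) (t : R) :
  0 <= a -> 0 <= b -> continuous3 Ez ->
  continuous (boundary_loss a b Rx Ry Ez) t.
Proof.
  intros Ha Hb CE.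
  assert (Htrace : forall (c : R) (g : R -> R -> R), 0 <= c -> continuous2 g ->
             continuous (fun t => L2norm1 c (g t) ^ 2) t).
  { intros c g Hc Hg.
    apply continuous_ext with (f := fun t => RInt (fun s => g t s ^ 2) (- c) c).
    - intros r. symmetry. apply L2norm1_sq; [exact Hc |].
      intros s. apply (continuous2_comp g (fun _ => r) (fun s => s)); cont.
    - apply (continuous_RInt_param (fun t s => g t s ^ 2)).
      intros p. simpl. cont. }
  unfold boundary_loss.
  cont.
  - apply (Htrace b (fun t y => Ez a y t)); [exact Hb | intros p; cont].
  - apply (Htrace b (fun t y => Ez (- a) y t)); [exact Hb | intros p; cont].
  - apply (Htrace a (fun t x => Ez x b t)); [exact Ha | intros p; cont].
  - apply (Htrace a (fun t x => Ez x (- b) t)); [exact Ha | intros p; cont].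
Qed.

Lemma gamma_ge0 (r : R) : Rabs r < 1 -> 0 <= gamma r.
Proof.
  intros Hr. apply Rabs_def2 in Hr.
  apply Rlt_le, Rdiv_lt_0_compat; lra.
Qed.

Lemma boundary_loss_ge0 (a b Rx Ry : R) (Ez : field) (t : R) :
  Rabs Rx < 1 -> Rabs Ry < 1 -> 0 <= boundary_loss a b Rx Ry Ez t.
Proof.
  intros HRx HRy.
  apply Rplus_le_le_0_compat;
    (apply Rmult_le_pos;
      [now apply gamma_ge0 | apply Rplus_le_le_0_compat; apply pow2_ge_0]).
Qed.

(** * Boundary conditions *)

(** The four sides differ by the sign in front of the magnetic component: on two
    of them the next two lemmas are applied with h the opposite of that
    component. *)
Lemma absorbing_product (r e h : R) :
  Rabs r < 1 -> (1 - r) / 2 * e - (1 + r) / 2 * h = 0 ->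
  e * h = gamma r * e ^ 2.
Proof.
  intros Hr Hbc. apply Rabs_def2 in Hr. unfold gamma.
  replace h with ((1 - r) / (1 + r) * e); [field; lra |].
  apply Rmult_eq_reg_l with ((1 + r) / 2); [| lra].
  replace ((1 + r) / 2 * ((1 - r) / (1 + r) * e)) with ((1 - r) / 2 * e)
    by (field; lra).
  lra.
Qed.

(** For r = 1 the condition forces h = 0, and for r = - 1 it forces e = 0. *)
Lemma reflecting_product (r e h : R) :
  Rabs r = 1 -> (1 - r) / 2 * e - (1 + r) / 2 * h = 0 -> e * h = 0.
Proof.
  intros Hr Hbc.
  assert (r = 1 \/ r = - 1) as [-> | ->]
    by (revert Hr; unfold Rabs; destruct Rcase_abs; lra).
  - replace h with 0 by lra. ring.
  - replace e with 0 by lra. ring.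
Qed.

(** The outward flux through the four sides of the vector field
    (Ez Hy, - Ez Hx), the energy current of the undamped system. *)
Definition boundary_flux (a b : R) (Ez Hy Hx : field) (t : R) : R :=
  RInt (fun y => Ez a y t * Hy a y t - Ez (- a) y t * Hy (- a) y t) (- b) b -
  RInt (fun x => Ez x b t * Hx x b t - Ez x (- b) t * Hx x (- b) t) (- a) a.

Lemma boundary_flux_absorbing (a b Rx Ry : R) (Ez Hy Hx : field) (t : R) :
  0 <= a -> 0 <= b -> 0 <= t -> continuous3 Ez ->
  Rabs Rx < 1 -> Rabs Ry < 1 ->
  boundary_x a b Rx Ez Hy -> boundary_y a b Ry Ez Hx ->
  boundary_flux a b Ez Hy Hx t = boundary_loss a b Rx Ry Ez t.
Proof.
  intros Ha Hb Ht CE HRx HRy Bx By. unfold boundary_flux, boundary_loss.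
  rewrite !L2norm1_sq by (assumption || (intros z; cont)).
  rewrite <- !RInt_Rplus by (intros z; simpl; cont).
  rewrite <- !RInt_Rmult_l by (intros z; simpl; cont).
  rewrite (RInt_ext
             (fun y => Ez a y t * Hy a y t - Ez (- a) y t * Hy (- a) y t)
             (fun y => gamma Rx * (Ez a y t ^ 2 + Ez (- a) y t ^ 2))).
  2:{ rewrite Rmin_left, Rmax_right by lra. intros y Hyb.
      destruct (Bx y t) as [Bp Bm]; [lra | lra |].
      rewrite (absorbing_product Rx _ _ HRx Bp).
      assert (Hm := absorbing_product Rx (Ez (- a) y t) (- Hy (- a) y t) HRx
                      ltac:(lra)).
      simpl. simpl in Hm. lra. }
  rewrite (RInt_ext
             (fun x => Ez x b t * Hx x b t - Ez x (- b) t * Hx x (- b) t)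
             (fun x => - 1 * (gamma Ry * (Ez x b t ^ 2 + Ez x (- b) t ^ 2)))).
  2:{ rewrite Rmin_left, Rmax_right by lra. intros x Hxa.
      destruct (By x t) as [Bp Bm]; [lra | lra |].
      rewrite (absorbing_product Ry _ _ HRy Bm).
      assert (Hp := absorbing_product Ry (Ez x b t) (- Hx x b t) HRy
                      ltac:(lra)).
      simpl. simpl in Hp. lra. }
  rewrite (RInt_Rmult_l (- 1)) by (intros z; simpl; cont).
  ring.
Qed.

Lemma boundary_flux_reflecting (a b Rx Ry : R) (Ez Hy Hx : field) (t : R) :
  0 <= a -> 0 <= b -> 0 <= t ->
  Rabs Rx = 1 -> Rabs Ry = 1 ->
  boundary_x a b Rx Ez Hy -> boundary_y a b Ry Ez Hx ->
  boundary_flux a b Ez Hy Hx t = 0.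
Proof.
  intros Ha Hb Ht HRx HRy Bx By. unfold boundary_flux.
  rewrite (RInt_ext _ (fun _ => 0)).
  2:{ rewrite Rmin_left, Rmax_right by lra. intros y Hyb.
      destruct (Bx y t) as [Bp Bm]; [lra | lra |].
      assert (Hp := reflecting_product Rx _ _ HRx Bp).
      assert (Hm := reflecting_product Rx (Ez (- a) y t) (- Hy (- a) y t) HRx
                      ltac:(lra)).
      lra. }
  rewrite (RInt_ext (fun x => _ - _) (fun _ => 0)).
  2:{ rewrite Rmin_left, Rmax_right by lra. intros x Hxa.
      destruct (By x t) as [Bp Bm]; [lra | lra |].
      assert (Hm := reflecting_product Ry _ _ HRy Bm).
      assert (Hp := reflecting_product Ry (Ez x b t) (- Hx x b t) HRy
                      ltac:(lra)).
      lra. }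
  rewrite !RInt_const.
  change (((b - - b) * 0) - ((a - - a) * 0) = 0). ring.
Qed.

(** * The energy estimate *)

(** Here e, h, k, p are the values of Ez, Hy, Hx, P at a point, with s the
    damping there and m an upper bound for it.  Once the equations are substituted, the
    right side exceeds the left by
    2 (m - s) (e^2 + h^2 + k^2 + p^2) + 4 s (e^2 + h^2 + p^2). *)
Lemma pml_pointwise (s m e h k p et ht kt pt hx ky ex ey : R) :
  0 <= s <= m ->
  et = - hx + ky - s * e -> ht = - ex - s * h ->
  kt = ey + s * (k - p) -> pt = s * (k - p) ->
  2 * (et * e + ht * h + kt * k + pt * p) <=
  - 2 * (ex * h + e * hx) + 2 * (ey * k + e * ky) +
  2 * m * (e * e + h * h + k * k + p * p).
Proof.
  intros Hs -> -> -> ->.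
  assert (0 <= (m - s) * (e * e + h * h + k * k + p * p)).
  { apply Rmult_le_pos; [lra |].
    pose proof (Rle_0_sqr e). pose proof (Rle_0_sqr h).
    pose proof (Rle_0_sqr k). pose proof (Rle_0_sqr p). unfold Rsqr in *. lra. }
  assert (0 <= s * (e * e + h * h + p * p)).
  { apply Rmult_le_pos; [lra |].
    pose proof (Rle_0_sqr e). pose proof (Rle_0_sqr h).
    pose proof (Rle_0_sqr p). unfold Rsqr in *. lra. }
  lra.
Qed.

(** The function e is the integral of d_t q over the rectangle.  The pointwise
    inequality bounds d_t q by - 2 d_x (Ez Hy) + 2 d_y (Ez Hx) + 2 s q; both
    sides are continuous up to the boundary, so it extends from the open to the
    closed domain although sigma may be discontinuous. *)
Lemma energy0_rate (a b s : R) (sigma : R -> R)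
    (Ez Ezx Ezy Ezt Hy Hyx Hyy Hyt Hx Hxx Hxy Hxt P Px Py Pt : field) :
  0 < a -> 0 < b ->
  C1_on_box a b Ez Ezx Ezy Ezt -> C1_on_box a b Hy Hyx Hyy Hyt ->
  C1_on_box a b Hx Hxx Hxy Hxt -> C1_on_box a b P Px Py Pt ->
  (forall x, - a <= x <= a -> 0 <= sigma x <= s) ->
  (forall x y t, open_domain a b x y t ->
     Ezt x y t = - Hyx x y t + Hxy x y t - sigma x * Ez x y t /\
     Hyt x y t = - Ezx x y t - sigma x * Hy x y t /\
     Hxt x y t = Ezy x y t + sigma x * (Hx x y t - P x y t) /\
     Pt x y t = sigma x * (Hx x y t - P x y t)) ->
  exists e : R -> R,
    (forall t, continuous e t) /\
    (forall t, 0 <= t ->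
       energy0 a b Ez Hy Hx P t = energy0 a b Ez Hy Hx P 0 + RInt e 0 t) /\
    (forall t, 0 <= t ->
       e t <= - 2 * boundary_flux a b Ez Hy Hx t +
              2 * s * energy0 a b Ez Hy Hx P t).
Proof.
  intros Ha Hb CE CHy CHx CP Hsigma Hpml.
  pose proof (C1_plus _ _ _ _ _ _ _ _ _ _
    (C1_plus _ _ _ _ _ _ _ _ _ _
      (C1_plus _ _ _ _ _ _ _ _ _ _
        (C1_mult _ _ _ _ _ _ _ _ _ _ CE CE) (C1_mult _ _ _ _ _ _ _ _ _ _ CHy CHy))
      (C1_mult _ _ _ _ _ _ _ _ _ _ CHx CHx)) (C1_mult _ _ _ _ _ _ _ _ _ _ CP CP))
    as Cq.
  pose proof (C1_mult _ _ _ _ _ _ _ _ _ _ CE CHy) as CEHy.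
  pose proof (C1_mult _ _ _ _ _ _ _ _ _ _ CE CHx) as CEHx.
  match type of Cq with C1_on_box _ _ _ _ _ ?w => set (qt := w) in Cq end.
  match type of CEHy with C1_on_box _ _ _ ?w _ _ => set (Fx := w) in CEHy end.
  match type of CEHx with C1_on_box _ _ _ _ ?w _ => set (Gy := w) in CEHx end.
  pose proof Cq as ((CCq & _ & _ & CCqt) & _).
  pose proof CEHy as ((_ & CFx & _) & _).
  pose proof CEHx as ((_ & _ & CGy & _) & _).
  assert (HE : forall t, energy0 a b Ez Hy Hx P t =
                         area a b (energy_density Ez Hy Hx P) t).
  { intros t. apply energy0_area; [lra | lra | apply CE | apply CHy | apply CHx
                                  | apply CP]. }
  exists (area a b qt). split; [| split].
  - intros t. now apply continuous_area.
  - intros t Ht. rewrite !HE.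
    now apply (area_growth a b _ _ _ qt t Ha Hb Cq).
  - intros t Ht. rewrite HE. unfold boundary_flux.
    rewrite <- (area_d_x a b _ _ _ _ t Ha Hb CEHy Ht).
    rewrite <- (area_d_y a b _ _ _ _ t Ha Hb CEHx Ht).
    set (q := energy_density Ez Hy Hx P) in *.
    change (continuous3 q) in CCq.
    replace (- 2 * (area a b Fx t - area a b Gy t) + 2 * s * area a b q t)
      with (area a b (fun x y t => - 2 * Fx x y t + 2 * Gy x y t +
                                   2 * s * q x y t) t).
    2:{ rewrite (area_plus a b (fun x y t => - 2 * Fx x y t + 2 * Gy x y t)
                   (fun x y t => 2 * s * q x y t)) by (intros p; cont).
        rewrite (area_plus a b (fun x y t => - 2 * Fx x y t)
                   (fun x y t => 2 * Gy x y t)) by (intros p; cont).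
        rewrite !area_scal by assumption. ring. }
    apply area_le; [lra | lra | assumption | intros p; cont |].
    intros x y Hxa Hyb.
    apply (le_on_closed_domain a b qt
             (fun x y t => - 2 * Fx x y t + 2 * Gy x y t + 2 * s * q x y t));
      [lra | lra | assumption | intros p; cont | | now repeat split].
    clear x y t Ht Hxa Hyb. intros x y t Hop.
    destruct (Hpml x y t Hop) as (E1 & E2 & E3 & E4).
    destruct Hop as (Hxa & _).
    assert (Hs := Hsigma x ltac:(lra)).
    assert (Hpw := pml_pointwise _ _ _ _ _ _ _ _ _ _ _ _ _ _ Hs E1 E2 E3 E4).
    unfold qt, Fx, Gy, q, energy_density. lra.
Qed.

Theorem theorem4p6 (x0 y0 delta : R) (x0_pos : 0 < x0) (y0_pos : 0 < y0)
    (delta_pos : 0 < delta)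
    (sigma : R -> R) (sigma_inf : R)
    (sigma_ge0 : forall x : R, - (x0 + delta) <= x <= x0 + delta -> 0 <= sigma x)
    (sigma_vanish : forall x : R, Rabs x <= x0 -> sigma x = 0)
    (sigma_max :
       is_max_on (fun x => - (x0 + delta) <= x <= x0 + delta) sigma sigma_inf)
    (Rx Ry : R) (Ez Hy Hx P : field)
    (Ez_smooth : C1_up_to_boundary (x0 + delta) y0 Ez)
    (Hy_smooth : C1_up_to_boundary (x0 + delta) y0 Hy)
    (Hx_smooth : C1_up_to_boundary (x0 + delta) y0 Hx)
    (P_smooth : C1_up_to_boundary (x0 + delta) y0 P)
    (pml : PML_system (x0 + delta) y0 sigma Ez Hy Hx P)
    (bc_x : boundary_x (x0 + delta) y0 Rx Ez Hy)
    (bc_y : boundary_y (x0 + delta) y0 Ry Ez Hx) :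
  (Rabs Rx < 1 /\ Rabs Ry < 1 ->
     sqrt_growth_le sigma_inf (energy (x0 + delta) y0 Rx Ry Ez Hy Hx P)) /\
  (Rabs Rx = 1 /\ Rabs Ry = 1 ->
     sqrt_growth_le sigma_inf (energy0 (x0 + delta) y0 Ez Hy Hx P)).
Proof.
  assert (Ha : 0 < x0 + delta) by lra.
  set (a := x0 + delta) in *. set (b := y0) in *.
  assert (Hsigma : forall x, - a <= x <= a -> 0 <= sigma x <= sigma_inf).
  { intros x Hxa. split; [now apply sigma_ge0 | now apply sigma_max]. }
  destruct (C1_extension a b Ez Ha y0_pos Ez_smooth)
    as (E & Ex & Ey & Et & CE & EE & DE).
  destruct (C1_extension a b Hy Ha y0_pos Hy_smooth)
    as (F & Fx & Fy & Ft & CF & EF & DF).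
  destruct (C1_extension a b Hx Ha y0_pos Hx_smooth)
    as (G & Gx & Gy & Gt & CG & EG & DG).
  destruct (C1_extension a b P Ha y0_pos P_smooth)
    as (Q & Qx & Qy & Qt & CQ & EQ & DQ).
  assert (Bx : boundary_x a b Rx E F).
  { intros y t Hyb Ht. rewrite !EE, !EF by (repeat split; lra).
    now apply bc_x. }
  assert (By : boundary_y a b Ry E G).
  { intros x t Hxa Ht. rewrite !EE, !EG by (repeat split; lra).
    now apply bc_y. }
  destruct (energy0_rate a b sigma_inf sigma E Ex Ey Et F Fx Fy Ft G Gx Gy Gt
              Q Qx Qy Qt Ha y0_pos CE CF CG CQ Hsigma) as (e & Ce & He & Hle).
  { intros x y t Hop.
    destruct (DE x y t Hop) as (<- & <- & <-).
    destruct (DF x y t Hop) as (<- & _ & <-).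
    destruct (DG x y t Hop) as (_ & <- & <-).
    destruct (DQ x y t Hop) as (_ & _ & <-).
    assert (Hcl : closed_domain a b (x, y, t)).
    { destruct Hop as (Hxa & Hyb & Ht). repeat split; lra. }
    rewrite EE, EF, EG, EQ by exact Hcl. now apply pml. }
  split; intros [HRx HRy].
  - apply sqrt_growth_le_ext with (E := energy a b Rx Ry E F G Q).
    { intros t Ht. apply energy_ext; auto; lra. }
    assert (CE' : continuous3 E) by apply CE.
    assert (Closs : forall t, continuous (boundary_loss a b Rx Ry E) t).
    { intros t. apply continuous_boundary_loss; [lra | lra | exact CE']. }
    apply (sqrt_growth_le_primitive sigma_inf (energy0 a b E F G Q 0) _
             (fun t => e t + 2 * boundary_loss a b Rx Ry E t)).
    + intros t. cont.
    + intros t Ht.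
      rewrite (RInt_Rplus e) by (intros r; cont).
      rewrite RInt_Rmult_l by exact Closs.
      unfold energy. rewrite (He t Ht).
      change (RInt (fun t' => _ + _) 0 t) with
        (RInt (boundary_loss a b Rx Ry E) 0 t).
      ring.
    + intros t Ht. specialize (Hle t Ht).
      rewrite (boundary_flux_absorbing a b Rx Ry) in Hle; auto; try lra.
      (* The inequality bounds the rate by energy0; the full energy is
         at least as large since gamma and sigma_inf are nonnegative. *)
      assert (Hpos : 0 <= 2 * sigma_inf * (energy a b Rx Ry E F G Q t -
                                         energy0 a b E F G Q t)).
      { apply Rmult_le_pos.
        - assert (Hs := Hsigma 0 ltac:(lra)). lra.
        - assert (0 <= RInt (boundary_loss a b Rx Ry E) 0 t).
          { apply RInt_ge_0; [exact Ht | |].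
            - now apply ex_RInt_continuous_everywhere.
            - intros r _. now apply boundary_loss_ge0. }
          change (0 <= energy0 a b E F G Q t +
                       2 * RInt (boundary_loss a b Rx Ry E) 0 t -
                       energy0 a b E F G Q t).
          lra. }
      lra.
  - apply sqrt_growth_le_ext with (E := energy0 a b E F G Q).
    { intros t Ht. apply energy0_ext; auto; lra. }
    apply (sqrt_growth_le_primitive sigma_inf _ _ e Ce He).
    intros t Ht. specialize (Hle t Ht).
    rewrite (boundary_flux_reflecting a b Rx Ry) in Hle; auto; lra.
Qed.
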